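(* For each integer $n\ge 4$, $$\psi_3(n)=\psi_{n-3}(n)=1+\left\lfloor\frac{n-3}{2}\right\rfloor+\left[\frac{1}{12}(n-3)^2\right],$$ where $[x]$ denotes the integer nearest to $x$.
   Context: The wheel $W_n$ is the join of the cycle $C_n$ (the outer cycle) and a single vertex: $V(W_n)=\{v,v_1,\dots,v_n\}$ and $E(W_n)=\{vv_i,\ v_iv_{i+1} : 1\le i\le n\}$ with subscripts modulo $n$; the outer cycle $C_n$ has edges $v_iv_{i+1}$. A signed graph $\Sigma=(G,\sigma)$ is a graph $G$ together with a function $\sigma:E(G)\to\{+1,-1\}$; an edge $e$ is negative if $\sigma(e)=-1$. Switching $\Sigma$ at a vertex $u$ changes the sign of every edge incident to $u$. Two signed graphs are isomorphic if there is a graph isomorphism between their underlying graphs preserving edge signs. Two signed graphs are switching isomorphic if one is isomorphic to a signed graph obtained from the other by a sequence of switchings. $(W_n,\sigma)^o$ denotes a signed wheel all of whose negative edges lie on the outer cycle $C_n$. For $0\le p\le n$, $\psi_p(n)$ denotes the number of switching non-isomorphic signed wheels of the form $(W_n,\sigma)^o$ with exactly $p$ negative edges (the number of equivalence classes of such signed wheels under switching isomorphism). *)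

(* Defs.v *)
From HB Require Import structures.
From mathcomp Require Import all_boot all_order all_fingroup all_algebra.
From mathcomp Require Import lra.

Set Implicit Arguments.
Unset Strict Implicit.
Unset Printing Implicit Defensive.

Import Order.TTheory GRing.Theory Num.Theory.

(* A graph on the vertex type V is given by its edge set E : {set {set V}}
   (a set of two-element sets of vertices when the graph is simple). *)
Section SignedGraphs.
Variable V : finType.
Implicit Types E F G : {set {set V}}.

Definition edge E := {e : {set V} | e \in E}.

(* The sign group {+1, -1} is encoded by bool, b standing for (-1)^b:
   true is the negative sign. *)
Definition signature E := {ffun edge E -> bool}.

Definition negative_edges E (s : signature E) : {set edge E} :=
  [set e : edge E | s e].

Definition switch E (u : V) (s : signature E) : signature E :=
  [ffun e : edge E => s e (+) (u \in val e)].

Definition switch_step E : rel (signature E) :=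
  fun s t => [exists u : V, t == switch u s].

Definition graph_iso E F (f : {perm V}) : bool :=
  [forall e : {set V}, (f @: e \in F) == (e \in E)].

Definition signed_iso E F (s : signature E) (t : signature F) : bool :=
  [exists f : {perm V}, graph_iso E F f &&
    [forall e : edge E, forall e' : edge F,
      (val e' == f @: val e) ==> (t e' == s e)]].

Definition switching_iso E F (s : signature E) (t : signature F) : bool :=
  [exists s' : signature E, connect (@switch_step E) s s' && signed_iso s' t].

Lemma switchK E u : involutive (@switch E u).
Proof. by move=> s; apply/ffunP => e; rewrite !ffunE addbK. Qed.

Lemma connect_switch_sym E : connect_sym (@switch_step E).
Proof.
suff sub : forall s t : signature E, connect (@switch_step E) s t ->
    connect (@switch_step E) t s by move=> s t; apply/idP/idP; apply: sub.
move=> s t /connectP[p + ->]; elim: p s => [|r p IH] s /=; first by rewrite connect0.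
move=> /andP[/existsP[u /eqP ru] pr]; apply: (connect_trans (IH r pr)).
by apply: connect1; apply/existsP; exists u; rewrite ru switchK.
Qed.

Lemma signed_iso_refl E (s : signature E) : signed_iso s s.
Proof.
have id1 (A : {set V}) : (1%g : {perm V}) @: A = A.
  by rewrite (eq_imset _ (@perm1 V)) imset_id.
apply/existsP; exists 1%g; apply/andP; split.
  by apply/forallP => e; rewrite id1.
apply/forallP => e; apply/forallP => e'; rewrite id1.
by apply/implyP => /eqP/val_inj ->.
Qed.

Lemma signed_iso_sym E F (s : signature E) (t : signature F) :
  signed_iso s t -> signed_iso t s.
Proof.
move=> /existsP[f /andP[/forallP fE /forallP fs]].
have fVK (A : {set V}) : f @: ((f^-1)%g @: A) = A.
  by rewrite -imset_comp (eq_imset _ (permKV f)) imset_id.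
apply/existsP; exists (f^-1)%g; apply/andP; split.
  by apply/forallP => e; rewrite eq_sym -{1}(fVK e) (fE _).
apply/forallP => e; apply/forallP => e'; apply/implyP => /eqP e'E.
rewrite eq_sym; have /forallP/(_ e)/implyP := fs e'; apply.
by rewrite e'E fVK.
Qed.

Lemma signed_iso_trans E F G (s : signature E) (t : signature F)
  (r : signature G) : signed_iso s t -> signed_iso t r -> signed_iso s r.
Proof.
move=> /existsP[f /andP[/forallP fE /forallP fs]].
move=> /existsP[g /andP[/forallP gE /forallP gs]].
have fgE (A : {set V}) : (f * g)%g @: A = g @: (f @: A).
  by rewrite -imset_comp; apply: eq_imset => x; rewrite permM.
apply/existsP; exists (f * g)%g; apply/andP; split.
  by apply/forallP => e; rewrite fgE (eqP (gE _)).
apply/forallP => e; apply/forallP => e'; rewrite fgE; apply/implyP => e'E.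
have fF : f @: val e \in F by rewrite (eqP (fE _)) (valP e).
pose h : edge F := Sub (f @: val e) fF.
have /forallP/(_ h)/implyP/(_ (eqxx _))/eqP <- := fs e.
by have /forallP/(_ e')/implyP/(_ e'E) := gs h.
Qed.

Lemma signed_iso_switch E F (s : signature E) (t t' : signature F) :
  signed_iso s t -> connect (@switch_step F) t t' ->
  exists2 s', connect (@switch_step E) s s' & signed_iso s' t'.
Proof.
move=> st /connectP[p + ->]; elim: p s t st => [|r p IH] s t st /=.
  by exists s; first exact: connect0.
move=> /andP[/existsP[u /eqP ru] pr].
have /existsP[f /andP[fE /forallP fs]] := st.
have st' : signed_iso (switch ((f^-1)%g u) s) r.
  apply/existsP; exists f; rewrite fE /=.
  apply/forallP => e; apply/forallP => e'; apply/implyP => e'E.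
  have /forallP/(_ e')/implyP/(_ e'E)/eqP ts := fs e.
  have -> : r e' = t e' (+) (u \in val e') by rewrite ru ffunE.
  rewrite ts ffunE; apply/eqP; congr (_ (+) _).
  have -> : val e' = f @: val e by exact/eqP.
  by rewrite -[RHS](mem_imset _ _ (@perm_inj _ f)) permKV.
have [s' cs' s't] := IH _ _ st' pr.
exists s' => //; apply: connect_trans cs'; apply: connect1.
by apply/existsP; exists ((f^-1)%g u).
Qed.

Lemma switching_iso_equiv E : equivalence_rel (@switching_iso E E).
Proof.
have rfl (s : signature E) : switching_iso s s.
  by apply/existsP; exists s; rewrite connect0 signed_iso_refl.
have sym (s t : signature E) : switching_iso s t -> switching_iso t s.
  move=> /existsP[s' /andP[ss' /signed_iso_sym ts']].
  rewrite connect_switch_sym in ss'.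
  have [t' tt' t's] := signed_iso_switch ts' ss'.
  by apply/existsP; exists t'; rewrite tt' t's.
have trn (s t r : signature E) :
    switching_iso s t -> switching_iso t r -> switching_iso s r.
  move=> /existsP[s' /andP[ss' s't]] /existsP[t' /andP[tt' t'r]].
  have [s'' s's'' s''t'] := signed_iso_switch s't tt'.
  apply/existsP; exists s''; rewrite (connect_trans ss' s's'').
  exact: signed_iso_trans s''t' t'r.
move=> s t r; split=> // st; apply/idP/idP; first exact/trn/sym.
exact: trn.
Qed.

End SignedGraphs.

(* The vertex None : option 'I_n is the hub v, and Some i is the rim vertex
   v_i, with ordS i the cyclic successor of i. *)
Section Wheel.
Variable n : nat.

Definition outer_cycle : {set {set option 'I_n}} :=
  [set [set Some i; Some (ordS i)] | i : 'I_n].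

Definition spokes : {set {set option 'I_n}} :=
  [set [set None; Some i] | i : 'I_n].

Definition wheel : {set {set option 'I_n}} := spokes :|: outer_cycle.

Definition outer_signed_wheel (s : signature wheel) : bool :=
  [forall e : edge wheel, (e \in negative_edges s) ==> (val e \in outer_cycle)].

Definition outer_signed_wheels (p : nat) : {set signature wheel} :=
  [set s | outer_signed_wheel s & #|negative_edges s| == p].

Lemma wheel_simple (e : {set option 'I_n}) : 2 < n -> e \in wheel -> #|e| = 2.
Proof.
move=> n2 /setUP[] /imsetP[i _ ->]; rewrite cards2 //=.
suff -> : Some i != Some (ordS i) by [].
apply/eqP => -[/(congr1 val) /= E]; have := ltn_ord i.
rewrite leq_eqVlt => /orP[/eqP Si|Si]; last first.
  by move: E; rewrite modn_small // => /n_Sn.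
by move: E; rewrite Si modnn => E; rewrite E in Si; rewrite -Si in n2.
Qed.

End Wheel.

Definition psi (p n : nat) : nat :=
  #|equivalence_partition (@switching_iso _ (wheel n) (wheel n))
      (outer_signed_wheels n p)|.

(* Halves are rounded up. *)
Definition nearest_int (x : rat) : int := Num.floor (x + 2^-1)%R.

Lemma nearest_int_dist (x : rat) :
  (`|x - (nearest_int x)%:~R| <= 2^-1 :> rat)%R.
Proof.
have /andP[] := floor_itv (x + 2^-1)%R; rewrite -/(nearest_int x) intrD.
by rewrite ler_norml; lra.
Qed.

(* Main.v *)
(** Switching leaves invariant the sign of every triangle through the hub, and
    when all the spokes are positive these signs are those of the rim edges.
    As n >= 4, every automorphism of the wheel fixes the hub and acts on the rim
    as a rotation or a reflection. So the classes with p negative edges are the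
    orbits of p-subsets of Z/n under the dihedral group, and complementation
    exchanges p and n - p. The orbit of a 3-subset is determined by its cyclic
    gaps up to order, so the orbits correspond to the partitions of n into three
    positive parts; writing f n for their number, removing 1 from each part
    gives f (n + 3) = f n + n/2 + 1, whence f n = (n^2 + 6)/12 (integer
    quotients). *)

Require Import Defs.
From mathcomp Require Import all_boot all_order all_fingroup all_algebra.
From mathcomp Require Import zify ring.

Import Order.TTheory GRing.Theory Num.Theory.
Local Open Scope ring_scope.

(** * Counting classes by representatives, and partitions into three parts *)

Lemma card_equivalence_partition {T I : finType} {R : rel T} {S : {set T}}
    {J : {set I}} {r : I -> T} :
    equivalence_rel R -> {in J, forall j, r j \in S} ->
    {in S, forall x, exists2 j, j \in J & R x (r j)} ->
    {in J &, forall i j, R (r i) (r j) -> i = j} ->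
  #|equivalence_partition R S| = #|J|.
Proof.
move=> eqR rS repS injr.
have Rxx x : R x x by case: (eqR x x x).
rewrite -(card_in_imset (f := fun j => [set y in S | R (r j) y])); last first.
  move=> i j iJ jJ /setP/(_ (r j)); rewrite !inE rS // Rxx /=; exact: injr.
congr #|pred_of_set _|; apply/setP => X; apply/imsetP/imsetP.
  move=> [x xS ->]; have [j jJ xj] := repS x xS; exists j => //.
  by apply/setP => y; rewrite !inE; case: (eqR x (r j) y) => _ ->.
by move=> [j jJ ->]; exists (r j) => //; apply: rS.
Qed.

Lemma floor_natr_div (m d : nat) : (0 < d)%N ->
  Num.floor (m%:R / d%:R : rat) = (m %/ d)%:Z.
Proof.
move=> d0; apply: floor_def; have d0' : 0 < d%:R :> rat by rewrite ltr0n.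
rewrite ler_pdivlMr // ltr_pdivrMr //.
have -> : ((m %/ d)%:Z + 1)%:~R = (m %/ d).+1%:R :> rat.
  by rewrite intrD -addn1 natrD.
by rewrite -!natrM ler_nat ltr_nat leq_trunc_div ltn_ceil.
Qed.

(* (a, b) stands for the partition a <= b <= n - a - b of n. *)
Definition triple_index (n : nat) : {set 'I_n.+1 * 'I_n.+1} :=
  [set ab : 'I_n.+1 * 'I_n.+1 |
     [&& 0 < ab.1, ab.1 <= ab.2 & ab.1 + ab.2.*2 <= n]%N].

Lemma sum_nat_interval (N l u : nat) :
  (\sum_(0 <= b < N) (l <= b < u) = minn N u - l)%N.
Proof.
elim: N => [|N IH]; first by rewrite big_geq // min0n.
by rewrite big_nat_recr //= IH; case: (leqP l N) => ?; case: (ltnP N u) => ? /=; lia.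
Qed.

(** For fixed [a] the second part runs over a <= b <= (n - a)/2; truncated subtraction yields 0 when
    this range is empty. *)
Lemma card_triple_index (n : nat) :
  #|triple_index n| = (\sum_(1 <= a < n.+1) (((n - a) %/ 2).+1 - a))%N.
Proof.
transitivity (\sum_(a < n.+1) \sum_(b < n.+1)
    [&& 0 < a, a <= b & a + b.*2 <= n])%N.
  rewrite pair_big -sum1_card big_mkcond /=; apply: eq_bigr => -[a b] _.
  by rewrite inE /=; case: ifP.
rewrite big_ord_recl big1 // add0n big_add1 big_mkord.
apply: eq_bigr => a _; have an := ltn_ord a; rewrite /= /bump leq0n add1n.
rewrite -(big_mkord xpredT (fun b => ((a.+1 <= b) && (a.+1 + b.*2 <= n))%N : nat)).
rewrite -(minn_idPr (_ : ((n - a.+1) %/ 2).+1 <= n.+1)%N); last by lia.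
by rewrite -sum_nat_interval; apply: eq_bigr => b _; congr nat_of_bool; lia.
Qed.

(** The term a = 1 counts the partitions with smallest part 1 and equals n/2 + 1; the term at a + 1
    for n + 3 is the term at a for n. *)
Lemma sum_triples_add3 (n : nat) :
  (\sum_(1 <= a < n.+4) (((n.+3 - a) %/ 2).+1 - a) =
   \sum_(1 <= a < n.+1) (((n - a) %/ 2).+1 - a) + (n %/ 2).+1)%N.
Proof.
rewrite big_nat_recl // [RHS]addnC; congr (_ + _)%N; first by lia.
rewrite (big_cat_nat (n := n.+1)) //=; last by lia.
(* The two topmost indices contribute 0 by truncated subtraction. *)
rewrite [X in (_ + X)%N]big_nat [X in (_ + X)%N]big1 ?addn0; last first.
  by move=> i Hi; lia.
by rewrite !big_nat; apply: eq_bigr => i Hi; lia.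
Qed.

(** Induction in steps of 6: with m = n - 6, two uses of the recurrence add m/2 + 1 + (m + 3)/2 + 1
    = m + 3 whatever the parity of m, and (m + 6)^2 - m^2 = 12(m + 3). *)
Lemma sum_triplesE (n : nat) :
  (\sum_(1 <= a < n.+1) (((n - a) %/ 2).+1 - a) = (n ^ 2 + 6) %/ 12)%N.
Proof.
elim/ltn_ind: n => n IH; case: (ltnP n 6) => n6.
  by do 6?[case: n IH n6 => [|n] IH n6; first by rewrite unlock].
have -> : n = (n - 6).+3.+3 by lia.
rewrite !sum_triples_add3 IH; last by lia.
have -> : ((n - 6).+3.+3 ^ 2 + 6 = (n - 6) ^ 2 + 6 + (n - 6 + 3) * 12)%N by nia.
by rewrite divnDMl //; lia.
Qed.

(** * Signed wheels with positive spokes, as subsets of Z/n *)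

Section SignedRim.
Variable k : nat.
Let n := k.+4.
Implicit Types (i j c : 'I_n) (A B : {set 'I_n}).

Lemma ordSE i : ordS i = i + 1.
Proof. by apply: val_inj; rewrite /= modnDmr addn1. Qed.

(** Applied below with m = 1, 2, 3, all smaller than n = k + 4. *)
Lemma natr_I_eq0 (m : nat) : (0 < m < n)%N -> (m%:R == 0 :> 'I_n) = false.
Proof.
move=> /andP[m0 mn]; apply/eqP => /(congr1 (@nat_of_ord n)).
by rewrite (@val_Zp_nat n) //= modn_small // => m00; rewrite m00 in m0.
Qed.

Lemma addr1_eq i : (i + 1 == i) = false.
Proof.
rewrite -subr_eq0; have -> : i + 1 - i = 1%:R by ring.
exact: natr_I_eq0.
Qed.

(* Indices are added modulo n, in the ring structure of 'I_k.+4. *)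
Definition rim i : {set option 'I_n} := [set Some i; Some (i + 1)].
Definition spoke i : {set option 'I_n} := [set None; Some i].

Lemma outer_cycleE : outer_cycle n = [set rim i | i : 'I_n].
Proof. by apply: eq_imset => i; rewrite ordSE. Qed.

Lemma rim_wheel i : rim i \in wheel n.
Proof. by rewrite inE outer_cycleE (imset_f rim) ?orbT. Qed.

Lemma spoke_wheel i : spoke i \in wheel n.
Proof. by rewrite inE (imset_f spoke). Qed.

Lemma wheelP (e : {set option 'I_n}) :
  e \in wheel n -> (exists i, e = spoke i) \/ (exists i, e = rim i).
Proof.
rewrite inE outer_cycleE => /orP[] /imsetP[i _ ->]; [left|right]; by exists i.
Qed.

(** Two equal rim edges with i <> j would force i = j + 1 and i + 1 = j, hence 2 = 0 modulo n. *)
Lemma rim_inj : injective rim.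
Proof.
move=> i j /setP ij; have := ij (Some i); have := ij (Some (i + 1)).
rewrite !inE !eqxx ?orbT => /esym ij1 /esym ij0.
move: ij0 ij1 => /orP[] /eqP/Some_inj ij0; first by [].
move=> /orP[] /eqP/Some_inj; last exact: addIr.
rewrite ij0 => /eqP; rewrite -subr_eq0; have -> : j + 1 + 1 - j = 2%:R by ring.
by rewrite natr_I_eq0.
Qed.

Lemma spoke_neq_rim i j : spoke i <> rim j.
Proof. by move=> /setP/(_ None); rewrite !inE. Qed.

Lemma pair_wheelP i j :
  [set Some i; Some j] \in wheel n -> j = i + 1 \/ j = i - 1.
Proof.
move=> /wheelP[] [h] /setP E; first by have := E None; rewrite !inE.
have sE (x y : 'I_n) : (Some x == Some y) = (x == y) by [].
have := E (Some (h + 1)); have := E (Some h); have := E (Some i).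
rewrite !inE !eqxx ?orbT /= !sE => /esym/orP[] /eqP -> /orP[] /eqP hj.
- by rewrite addr1_eq => /eqP <-; left.
- by rewrite -hj addr1_eq.
- by have := addr1_eq h; rewrite -hj eqxx.
- by right; rewrite -hj addrK.
Qed.

Definition rim_signature A : signature (wheel n) :=
  [ffun e => val e \in rim @: A].

Lemma rim_signature_rim A i (e : edge (wheel n)) :
  val e = rim i -> rim_signature A e = (i \in A).
Proof. by move=> eE; rewrite ffunE eE mem_imset //; apply: rim_inj. Qed.

Lemma rim_signature_spoke A i (e : edge (wheel n)) :
  val e = spoke i -> rim_signature A e = false.
Proof.
by move=> eE; rewrite ffunE eE; apply/imsetP => -[j _ /spoke_neq_rim].
Qed.

Definition rim_edge i : edge (wheel n) := exist _ (rim i) (rim_wheel i).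
Definition spoke_edge i : edge (wheel n) := exist _ (spoke i) (spoke_wheel i).

Lemma rim_signature_spoke_edge A i : rim_signature A (spoke_edge i) = false.
Proof. exact: (rim_signature_spoke _ i). Qed.

Lemma rim_signature_rim_edge A i : rim_signature A (rim_edge i) = (i \in A).
Proof. exact: rim_signature_rim. Qed.

Lemma card_negative_rim_signature A :
  #|negative_edges (rim_signature A)| = #|A|.
Proof.
have -> : negative_edges (rim_signature A) = rim_edge @: A.
  apply/setP => e; rewrite inE ffunE; apply/imsetP/imsetP => -[i iA E].
    by exists i => //; apply: val_inj.
  by exists i => //; rewrite E.
by apply: card_imset => i j /(congr1 val) /rim_inj.
Qed.

Lemma mem_outer_signed_wheels (p : nat) A :
  #|A| = p -> rim_signature A \in outer_signed_wheels n p.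
Proof.
move=> Ap; rewrite inE card_negative_rim_signature Ap eqxx andbT.
apply/forallP => e; apply/implyP; rewrite inE ffunE => /imsetP[i _ ->].
by rewrite outer_cycleE (imset_f rim).
Qed.

Lemma outer_signed_wheelsP (p : nat) (s : signature (wheel n)) :
  s \in outer_signed_wheels n p -> exists2 A, s = rim_signature A & #|A| = p.
Proof.
rewrite inE => /andP[/forallP os /eqP <-].
have sE : s = rim_signature [set i | s (rim_edge i)].
  apply/ffunP => e; have [[i eE]|[i eE]] := wheelP _ (valP e).
    rewrite (rim_signature_spoke _ _ _ eE); apply: contraTF (os e) => se.
    rewrite inE se /= outer_cycleE eE.
    by apply/imsetP => -[j _ /spoke_neq_rim].
  rewrite (rim_signature_rim _ _ _ eE) inE.
  by congr (s _); apply: val_inj.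
by exists [set i | s (rim_edge i)] => //; rewrite -card_negative_rim_signature -sE.
Qed.

Definition triangle_sign (s : signature (wheel n)) i : bool :=
  s (spoke_edge i) (+) s (spoke_edge (i + 1)) (+) s (rim_edge i).

Lemma triangle_sign_rim_signature A i :
  triangle_sign (rim_signature A) i = (i \in A).
Proof.
by rewrite /triangle_sign !rim_signature_spoke_edge rim_signature_rim_edge.
Qed.

(** Each vertex lies on two or none of the three edges of a triangle, so the sign changes cancel. *)
Lemma triangle_sign_switch u s i :
  triangle_sign (switch u s) i = triangle_sign s i.
Proof.
have i1 : (i == i + 1) = false by rewrite eq_sym addr1_eq.
have sE (x y : 'I_n) : (Some x == Some y) = (x == y) by [].
rewrite /triangle_sign !ffunE /= !inE.
case: u => [u|] /=; last by rewrite addbT addbT addbF; do 3!case: (s _).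
rewrite !sE; case: (eqVneq u i) => [->|_]; first by rewrite i1 /=; do 3!case: (s _).
by case: (u == i + 1); do 3!case: (s _).
Qed.

Lemma triangle_sign_connect s t :
  connect (@switch_step _ (wheel n)) s t -> triangle_sign s =1 triangle_sign t.
Proof.
move=> /connectP[p + ->] i; elim: p s => [|r p IH] s //=.
by move=> /andP[/existsP[u /eqP ->]] /IH <-; rewrite triangle_sign_switch.
Qed.

(** * Automorphisms of the wheel and the dihedral group *)

(** The elements of [A] and [B] index rim edges, so the maps i + c and c - i are the dihedral action
    on edges, not on vertices. *)
Definition dihedral_equiv A B : Prop :=
  exists c, (forall i, (i \in A) = (i + c \in B)) \/
            (forall i, (i \in A) = (c - i \in B)).

(* The hub is adjacent to all other vertices, whereas i and i + 2 are not
   adjacent on the rim when n >= 4. *)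
Lemma graph_iso_hub (f : {perm option 'I_n}) :
  graph_iso (wheel n) (wheel n) f -> f None = None.
Proof.
move=> /forallP fE; case fN : (f None) => [h|] //.
(* If the hub goes to the rim vertex h, any other rim vertex x is the image of a rim vertex y, and
   the spoke at y goes to the edge {h, x}. *)
have adj x : x != h -> x = h + 1 \/ x = h - 1.
  move=> xh; apply: pair_wheelP.
  case gx : (f^-1%g (Some x)) => [y|]; last first.
    by move: xh; rewrite -(inj_eq (@Some_inj _)) -fN -gx permKV eqxx.
  have := eqP (fE (spoke y)); rewrite spoke_wheel.
  by rewrite /spoke imsetU1 imset_set1 fN -gx permKV.
have h2 : h + 2%:R != h by rewrite -subr_eq0 addrAC subrr add0r natr_I_eq0.
case: (adj _ h2) => /eqP; rewrite -subr_eq0.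
  have -> : h + 2%:R - (h + 1) = 1%:R by ring.
  by rewrite natr_I_eq0.
have -> : h + 2%:R - (h - 1) = 3%:R by ring.
by rewrite natr_I_eq0.
Qed.

(** Injectivity forbids turning back, since i + 2 and i differ; the direction of the first step
    therefore persists around the cycle. *)
Lemma adjacent_injection (g : 'I_n -> 'I_n) :
    injective g -> (forall i, g (i + 1) = g i + 1 \/ g (i + 1) = g i - 1) ->
  (forall i, g i = g 0 + i) \/ (forall i, g i = g 0 - i).
Proof.
move=> gI gS.
have step e (m : nat) : g (m%:R + 1) = g m%:R + e -> e = 1 \/ e = - 1 ->
    g (m.+1%:R + 1) = g m.+1%:R + e.
  move=> gm e1; have mE : m.+1%:R = m%:R + 1 :> 'I_n by exact: mulrSr.
  have ne : g (m.+1%:R + 1) <> g m%:R.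
    move=> /gI/eqP; rewrite mE -subr_eq0.
    have -> : m%:R + 1 + 1 - m%:R = 2%:R :> 'I_n by ring.
    by rewrite natr_I_eq0.
  case: (gS m.+1%:R) e1 => gm1 [] eE; rewrite gm1 ?eE //; case: ne.
    by rewrite gm1 mE gm eE subrK.
  by rewrite gm1 mE gm eE addrK.
have all e : g (0 + 1) = g 0 + e -> e = 1 \/ e = - 1 -> 
   forall i, g i = g 0 + e * i.
  move=> g1 e1 i; rewrite -[i]natr_Zp.
  have gm (m : nat) : g (m%:R + 1) = g m%:R + e.
    by elim: m => [//|m IH]; apply: step.
  elim: (i : nat) => [|m IH]; first by rewrite mulr0 addr0.
  by rewrite mulrSr gm IH; ring.
case: (gS 0) => g1; [left|right] => i; rewrite (all _ g1); try ring; by auto.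
Qed.

Lemma switching_iso_dihedral A B :
  switching_iso (rim_signature A) (rim_signature B) -> dihedral_equiv A B.
Proof.
move=> /existsP[s /andP[/triangle_sign_connect AE /existsP[f /andP[fE fs]]]].
have f0 := graph_iso_hub f fE.
(* The default 0 is never taken: [f] is injective and already sends the hub to the hub. *)
pose g i := odflt 0 (f (Some i)).
have fS i : f (Some i) = Some (g i).
  rewrite /g; case E : (f (Some i)) => [//|].
  by have := E; rewrite -f0 => /perm_inj.
have gI : injective g.
  by move=> i j gij; have := fS i; rewrite gij -fS => /perm_inj [].
have f_spoke i : f @: spoke i = spoke (g i).
  by rewrite imsetU1 imset_set1 f0 fS.
have f_rim i : f @: rim i = [set Some (g i); Some (g (i + 1))].
  by rewrite imsetU1 imset_set1 !fS.
have gS i : g (i + 1) = g i + 1 \/ g (i + 1) = g i - 1.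
  apply: pair_wheelP; rewrite -f_rim.
  by move: fE => /forallP/(_ (rim i))/eqP ->; apply: rim_wheel.
have sE (e e' : edge (wheel n)) : val e' = f @: val e ->
    s e = rim_signature B e'.
  move=> e'E; apply/esym/eqP; move: fs => /forallP/(_ e)/forallP/(_ e')/implyP.
  by apply; apply/eqP.
(* The triangle sign of [s] over edge i is that of [A]; [f] carries it to the triangle over edge j,
   where both spokes are positive for [B]. *)
have tE i j : f @: rim i = rim j -> (i \in A) = (j \in B).
  move=> fij; rewrite -triangle_sign_rim_signature AE /triangle_sign.
  rewrite (sE _ (spoke_edge (g i))) ?f_spoke //.
  rewrite (sE _ (spoke_edge (g (i + 1)))) ?f_spoke //.
  rewrite (sE _ (rim_edge j)) ?fij //.
  by rewrite !rim_signature_spoke_edge rim_signature_rim_edge.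
case: (adjacent_injection g gI gS) => gE.
  exists (g 0); left => i; apply: tE.
  by rewrite f_rim (gE i) (gE (i + 1)) addrA (addrC i).
(* A reflection of the vertices shifts by one on the edges {i, i + 1}. *)
exists (g 0 - 1); right => i; apply: tE.
by rewrite f_rim (gE i) (gE (i + 1)) setUC opprD addrA [g 0 - 1 - i]addrAC /rim subrK.
Qed.

(** [g] and [h] are the actions on rim vertices and on rim edges, which differ for a reflection. *)
Lemma switching_iso_rim_perm (f : {perm option 'I_n}) (g h : 'I_n -> 'I_n) A B :
    (forall i, f @: spoke i = spoke (g i)) ->
    (forall i, f @: rim i = rim (h i)) ->
    (forall i, (i \in A) = (h i \in B)) ->
  switching_iso (rim_signature A) (rim_signature B).
Proof.
move=> fs fr AB; apply/existsP; exists (rim_signature A); rewrite connect0 /=.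
have fI : injective (fun e : {set option 'I_n} => f @: e).
  by apply: imset_inj; apply: perm_inj.
apply/existsP; exists f; apply/andP; split.
  (* The image lies in the wheel and has the same cardinality, so non-edges are preserved as
     well. *)
  have fW : (fun e : {set option 'I_n} => f @: e) @: wheel n = wheel n.
    apply/eqP; rewrite eqEcard card_imset // leqnn andbT.
    apply/subsetP => _ /imsetP[e /wheelP[] [i ->] ->].
      by rewrite fs spoke_wheel.
    by rewrite fr rim_wheel.
  by apply/forallP => e; rewrite -{1}fW (mem_imset _ _ fI).
apply/forallP => e; apply/forallP => e'; apply/implyP => /eqP e'E; apply/eqP.
have [[i eE]|[i eE]] := wheelP _ (valP e).
  rewrite (rim_signature_spoke _ _ _ eE) (rim_signature_spoke _ (g i)) //.
  by rewrite e'E eE fs.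
by rewrite (rim_signature_rim _ _ _ eE) (rim_signature_rim _ (h i)) ?AB // e'E eE fr.
Qed.

Lemma dihedral_switching_iso A B :
  dihedral_equiv A B -> switching_iso (rim_signature A) (rim_signature B).
Proof.
case=> c [] AB.
  have fI : injective (omap (fun i => i + c)).
    by apply: inj_omap; apply: addIr.
  apply: (switching_iso_rim_perm (perm fI) (fun i => i + c) (fun i => i + c)) => // i.
    by rewrite imsetU1 imset_set1 !permE.
  by rewrite imsetU1 imset_set1 !permE /= addrAC.
(* The vertex map i -> c + 1 - i sends {i, i + 1} to {c + 1 - i, c - i}, which is the rim edge c -
   i. *)
have fI : injective (omap (fun i => c + 1 - i)).
  by apply: inj_omap => i j /addrI/oppr_inj.
apply: (switching_iso_rim_perm (perm fI) (fun i => c + 1 - i) (fun i => c - i)) => // i.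
  by rewrite imsetU1 imset_set1 !permE.
rewrite imsetU1 imset_set1 !permE /= setUC /rim.
by congr [set Some _; Some _]; ring.
Qed.

End SignedRim.

(** * Dihedral orbits of triples and their cyclic gaps *)

(** Here x, y, z stand for the images of 0, p, p + q in {0, p', p' + q'}. The two final alternatives
    are rotation and reflection, each addition modulo n wrapping at most once; every case is linear
    arithmetic. *)
Lemma sorted_gaps_unique (n p q p' q' x y z : nat) :
    [&& 0 < p, p <= q & p + q.*2 <= n]%N ->
    [&& 0 < p', p' <= q' & p' + q'.*2 <= n]%N ->
    [\/ x = 0, x = p' | x = p' + q']%N ->
    [\/ y = 0, y = p' | y = p' + q']%N ->
    [\/ z = 0, z = p' | z = p' + q']%N ->
    (y = x + p \/ x + p = n + y)%N /\ (z = x + (p + q) \/ x + (p + q) = n + z)%N \/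
    (x = y + p \/ y + p = n + x)%N /\ (x = z + (p + q) \/ z + (p + q) = n + x)%N ->
  p = p' /\ q = q'.
Proof.
move=> /and3P[p0 pq pqn] /and3P[p0' pq' pqn'].
by move=> [] -> [] -> [] -> [[] | []] [] ? [] ?; lia.
Qed.

Section DihedralTriples.
Variable k : nat.
Let n := k.+4.
Implicit Types (c x y z : 'I_n) (A B C : {set 'I_n}) (p q r : nat).
Local Notation dihedral_equiv := (dihedral_equiv k).

(** The family [R] is arbitrary so as to serve both for triples and for their complements. *)
Lemma psi_card (I : finType) (J : {set I}) (R : I -> {set 'I_n}) p :
    {in J, forall j, #|R j| = p} ->
    (forall A, #|A| = p -> exists2 j, j \in J & dihedral_equiv A (R j)) ->
    {in J &, forall i j, dihedral_equiv (R i) (R j) -> i = j} ->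
  psi p n = #|J|.
Proof.
move=> Rp RE RI; apply: (card_equivalence_partition (r := fun j => rim_signature k (R j))).
- exact: switching_iso_equiv.
- by move=> j /Rp; apply: mem_outer_signed_wheels.
- move=> _ /outer_signed_wheelsP[A -> /RE[j jJ Aj]]; exists j => //.
  exact: dihedral_switching_iso.
- by move=> i j iJ jJ /switching_iso_dihedral /(RI _ _ iJ jJ).
Qed.

Lemma dihedral_equiv_trans A B C :
  dihedral_equiv A B -> dihedral_equiv B C -> dihedral_equiv A C.
Proof.
move=> [c AB] [d BC]; case: AB BC => AB [] BC.
- by exists (c + d); left => i; rewrite AB BC addrA.
- by exists (d - c); right => i; rewrite AB BC; congr (in_mem _ _); ring.
- by exists (c + d); right => i; rewrite AB BC; congr (in_mem _ _); ring.
- by exists (d - c); left => i; rewrite AB BC; congr (in_mem _ _); ring.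
Qed.

Lemma dihedral_equivC A B :
  dihedral_equiv A B -> dihedral_equiv (~: A) (~: B).
Proof. by case=> c [] AB; exists c; [left|right] => i; rewrite !inE AB. Qed.

Lemma dihedral_translate c x y z :
  dihedral_equiv [set x; y; z] [set x + c; y + c; z + c].
Proof. by exists c; left => i; rewrite !inE !(inj_eq (addIr c)). Qed.

Lemma dihedral_reflect c x y z :
  dihedral_equiv [set x; y; z] [set c - x; c - y; c - z].
Proof.
have cI : injective (fun i => c - i) by move=> i j /addrI/oppr_inj.
by exists c; right => i; rewrite !inE !(inj_eq cI).
Qed.

(** The triple through 0 with successive cyclic gaps p, q and n - p - q. *)
Definition gap_triple p q : {set 'I_n} := [set 0; p%:R; (p + q)%:R].

(** Translation by -p puts the second point at 0 and sends the point 0 to -p = q + r, turning the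
    gaps (p, q, r) into (q, r, p). *)
Lemma gap_triple_rot p q r : (p + q + r)%N = n ->
  dihedral_equiv (gap_triple p q) (gap_triple q r).
Proof.
move=> pqr; have pE : p%:R = - (q + r)%:R :> 'I_n.
  by apply/eqP; rewrite -addr_eq0 -natrD addnA pqr (@pchar_Zp n).
have -> : gap_triple q r = [set 0 - p%:R; p%:R - p%:R; (p + q)%:R - p%:R].
  rewrite subrr natrD addrAC subrr !add0r [in - _]pE opprK /gap_triple.
  by rewrite [LHS]setUC setUA.
exact: dihedral_translate.
Qed.

(** The reflection i -> p + q - i exchanges the two end points and sends p to q. *)
Lemma gap_triple_swap p q : dihedral_equiv (gap_triple p q) (gap_triple q p).
Proof.
have -> : gap_triple q p =
    [set (p + q)%:R - 0; (p + q)%:R - p%:R; (p + q)%:R - (p + q)%:R].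
  rewrite subr0 subrr addnC natrD addrK /gap_triple natrD.
  by rewrite [LHS]setUC [in LHS]setUC [RHS]setUC [in RHS](setUC [set _ + _]) setUA.
exact: dihedral_reflect.
Qed.

Definition sorted_gaps a b := [&& 0 < a, a <= b & a + b.*2 <= n]%N.

(** Cyclic rotation and the swap generate all permutations of the three gaps. *)
Lemma gap_triple_sort p q r :
    (0 < p)%N -> (0 < q)%N -> (0 < r)%N -> (p + q + r)%N = n ->
  exists ab, sorted_gaps ab.1 ab.2 /\
    dihedral_equiv (gap_triple p q) (gap_triple ab.1 ab.2).
Proof.
move=> p0 q0 r0 pqr; rewrite /sorted_gaps.
have pq_qr := gap_triple_rot p q r pqr.
have qr_rp : dihedral_equiv (gap_triple q r) (gap_triple r p).
  by apply: gap_triple_rot; lia.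
have pq_rp := dihedral_equiv_trans _ _ _ pq_qr qr_rp.
have rp_pq : dihedral_equiv (gap_triple r p) (gap_triple p q).
  by apply: gap_triple_rot; lia.
(* Three rotations give the identity, which supplies reflexivity. *)
have pq_pq := dihedral_equiv_trans _ _ _ pq_rp rp_pq.
have sw a b := dihedral_equiv_trans _ _ _ ^~ (gap_triple_swap a b).
case: (leqP p q) => pq; case: (leqP q r) => qr; case: (leqP p r) => pr.
- by exists (p, q); split=> //=; lia.
- by lia.
- by exists (p, r); split; [rewrite /=; lia | apply: sw].
- by exists (r, p); split=> //=; lia.
- by exists (q, p); split; [rewrite /=; lia | apply: sw].
- by exists (q, r); split=> //=; lia.
- by lia.
- by exists (r, q); split; [rewrite /=; lia | apply: sw].
Qed.

(** Translating one element to 0 leaves representatives u < w of the other two, with gaps u, w - u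
    and n - w. *)
Lemma card3_gap_triple A : #|A| = 3%N ->
  exists ab, sorted_gaps ab.1 ab.2 /\
    dihedral_equiv A (gap_triple ab.1 ab.2).
Proof.
move=> A3; have /card_gt0P[x xA] : (0 < #|A|)%N by rewrite A3.
have : #|A :\ x| == 2%N by move: A3; rewrite (cardsD1 x) xA => /eqP.
move=> /cards2P[y [z [yz Ax]]].
have Axyz : A = [set x; y; z] by rewrite -setUA -Ax setD1K.
have xE u : u \in [set y; z] -> u - x != 0.
  by rewrite -Ax !inE subr_eq0 => /andP[].
have yx : y - x != 0 by rewrite xE ?set21.
have zx : z - x != 0 by rewrite xE ?set22.
have {yz} yzx : y - x != z - x by rewrite (inj_eq (addIr _)).
have := dihedral_translate (- x) x y z; rewrite -Axyz subrr.
move: (y - x) (z - x) yx zx yzx {xE Ax Axyz} => u w.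
wlog uw : u w / (u < w)%N => [hw u0 w0 neq Auw|].
  case: (ssrnat.ltngtP u w) => [uw|wu|/ord_inj uw]; first exact: (hw u w).
    by apply: (hw w u wu w0 u0); rewrite 1?setUAC // eq_sym.
  by rewrite uw eqxx in neq.
move=> u0 w0 _ Auw.
have val0 (i : 'I_n) : i != 0 -> (0 < i)%N.
  by rewrite lt0n; apply: contraNN => /eqP i0; apply/eqP/ord_inj.
have := val0 _ u0; have := ltn_ord w; move=> wn u0'.
have [|||ab [abs abE]] := gap_triple_sort u (w - u) (n - w) u0'; try lia.
exists ab; split=> //; apply: dihedral_equiv_trans abE.
by rewrite /gap_triple subnKC ?natr_Zp // ltnW.
Qed.

Lemma val_natr p : (p < n)%N -> (p%:R : 'I_n) = p :> nat.
Proof. by move=> pn; rewrite (@val_Zp_nat n) // modn_small. Qed.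

Lemma mem_gap_tripleP i p q : (p + q < n)%N ->
  i \in gap_triple p q -> [\/ i = 0 :> nat, i = p :> nat | i = p + q :> nat].
Proof.
move=> pqn; rewrite !inE -orbA => /or3P[] /eqP ->.
- by apply: Or31.
- by apply: Or32; rewrite val_natr //; lia.
- by apply: Or33; rewrite val_natr.
Qed.

Lemma card_gap_triple p q : (0 < p)%N -> (0 < q)%N -> (p + q < n)%N ->
  #|gap_triple p q| = 3%N.
Proof.
move=> p0 q0 pqn; rewrite /gap_triple setUC cardsU1 cards2 !inE.
have ne (i j : 'I_n) : (i : nat) != j -> i != j by apply: contraNneq => ->.
rewrite (negbTE (ne (p + q)%:R 0 _)); last by rewrite val_natr //=; lia.
rewrite (negbTE (ne (p + q)%:R p%:R _)); last by rewrite !val_natr //=; lia.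
by rewrite (ne 0 p%:R) // val_natr /=; lia.
Qed.

Lemma gap_triple_inj p q p' q' :
    sorted_gaps p q -> sorted_gaps p' q' ->
  dihedral_equiv (gap_triple p q) (gap_triple p' q') -> p = p' /\ q = q'.
Proof.
move=> pqS pqS' [c AB].
have /and3P[p0 pq pqn] := pqS; have /and3P[p0' pq' pqn'] := pqS'.
(* Addition modulo n, read on representatives, either does not wrap or wraps once. *)
have valD (i : 'I_n) (m : nat) : (m < n)%N ->
    (i + m%:R)%R = (i + m)%N :> nat \/ (i + m)%N = (n + (i + m%:R)%R)%N.
  move=> mn; have ik := ltn_ord i.
  have -> : (i + m%:R)%R = ((i + m) %% n)%N :> nat.
    by rewrite -{2}(val_natr m mn).
  case: (ltnP (i + m) n) => imn; first by left; rewrite modn_small.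
  right; rewrite -{2}(subnK imn) modnDr modn_small; lia.
have pq_lt : (p + q < n)%N by lia.
have p_lt : (p < n)%N by lia.
have pq_lt' : (p' + q' < n)%N by lia.
have memP := mem_gap_tripleP _ _ _ pq_lt'.
have m0 : 0 \in gap_triple p q by rewrite !inE eqxx.
have m1 : p%:R \in gap_triple p q by rewrite !inE eqxx ?orbT.
have m2 : (p + q)%:R \in gap_triple p q by rewrite !inE eqxx ?orbT.
case: AB => AB; rewrite !AB in m0 m1 m2; move: (memP _ m0) (memP _ m1) (memP _ m2).
  rewrite add0r !(addrC _ c) => x0 x1 x2.
  apply: (sorted_gaps_unique _ _ _ _ _ _ _ _ pqS pqS' x0 x1 x2); left.
  by split; apply: valD.
rewrite subr0 => x0 x1 x2.
apply: (sorted_gaps_unique _ _ _ _ _ _ _ _ pqS pqS' x0 x1 x2); right.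
(* Under a reflection the images are c, c - p, c - (p + q): adding p or p + q to the latter two
   leads back to c. *)
have := valD (c - p%:R) _ p_lt; have := valD (c - (p + q)%:R) _ pq_lt.
by rewrite !subrK.
Qed.

Lemma triple_indexP (ab : nat * nat) : sorted_gaps ab.1 ab.2 ->
  exists2 j, j \in triple_index n & (j.1 = ab.1 :> nat) /\ (j.2 = ab.2 :> nat).
Proof.
case: ab => a b /= abn; have /and3P[a0 ab ab_le] := abn.
exists (inord a, inord b); rewrite ?inE /= !inordK //; lia.
Qed.

Lemma triple_index_inj (R : nat -> nat -> {set 'I_n}) :
    (forall p q p' q', sorted_gaps p q -> sorted_gaps p' q' ->
      dihedral_equiv (R p q) (R p' q') -> p = p' /\ q = q') ->
  {in triple_index n &, forall i j : 'I_n.+1 * 'I_n.+1,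
    dihedral_equiv (R i.1 i.2) (R j.1 j.2) -> i = j}.
Proof.
move=> RI [a b] [a' b']; rewrite !inE /= => ab ab' /RI[] // /ord_inj -> /ord_inj ->.
by [].
Qed.

Lemma psi3 : psi 3 n = #|triple_index n|.
Proof.
apply: (psi_card _ (triple_index n) (fun j => gap_triple j.1 j.2)).
- move=> [a b]; rewrite inE /= => /and3P[a0 ab abn].
  by apply: card_gap_triple; lia.
- move=> A /card3_gap_triple[ab [/triple_indexP[j jJ [j1 j2]] AE]].
  by exists j => //; rewrite j1 j2.
- exact/triple_index_inj/gap_triple_inj.
Qed.

(** Complements of the same representatives work, because dihedral equivalence passes to
    complements. *)
Lemma psi_sub3 : psi (n - 3) n = #|triple_index n|.
Proof.
apply: (psi_card _ (triple_index n) (fun j => ~: gap_triple j.1 j.2)).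
- move=> [a b]; rewrite inE /= => /and3P[a0 ab abn].
  by rewrite cardsCs setCK card_ord card_gap_triple //; lia.
- move=> A An; have : #|~: A| = 3%N by rewrite cardsCs setCK card_ord An; lia.
  move=> /card3_gap_triple[ab [/triple_indexP[j jJ [j1 j2]] /dihedral_equivC AE]].
  by exists j => //; rewrite j1 j2 -[A]setCK.
- apply: (triple_index_inj (fun p q => ~: gap_triple p q)) => p q p' q' pq pq'.
  by move=> /dihedral_equivC; rewrite !setCK; apply: gap_triple_inj.
Qed.

End DihedralTriples.

Theorem lemma3p4 (n : nat) (hn : (4 <= n)%N) :
  psi 3 n = psi (n - 3)%N n /\
  (psi 3 n)%:Z =
    1 + Num.floor ((n%:R - 3) / 2 : rat) + nearest_int ((n%:R - 3) ^+ 2 / 12).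
Proof.
case: n hn => [|[|[|[|k]]]] // _.
rewrite psi_sub3 psi3; split=> //.
rewrite /nearest_int -(natrB _ (isT : (3 <= k.+4)%N)) -natrX.
(* Rounding adds 1/2 = 6/12 before the floor, which accounts for the 6 in [sum_triplesE], here used
   at n - 3. *)
have -> : ((k.+4 - 3) ^ 2)%:R / 12 + 2^-1 = ((k.+4 - 3) ^ 2 + 6)%:R / 12%:R :> rat.
  by rewrite natrD; field.
rewrite !floor_natr_div // card_triple_index -sum_triplesE.
(* One use of the recurrence from n - 3 to n produces the remaining terms 1 + (n - 3)/2. *)
have -> : k.+4 = (k.+4 - 3).+3 by lia.
by rewrite sum_triples_add3 subSS; lia.
Qed.
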